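(* There is an absolute constant $n_0$ such that the following holds. Let $T$ be a tree with $n\ge n_0$ vertices and maximum degree $\Delta$, and let $v$ be an arbitrary vertex of $T$. Let $G$ be an $n$-vertex graph with minimum degree $\delta(G)\ge n-n/(\Delta(\log n)^5)$ and let $x\in V(G)$. If $p\ge \Delta(\log n)^5/n$, then with probability at least $1-n^{-3}$ there is an embedding of $T$ into $G_p$ that maps $v$ to $x$.
   Context: For a graph $G$ and $p\in[0,1]$, $G_p$ denotes the random subgraph of $G$ obtained by keeping each edge of $G$ independently with probability $p$. An embedding of $T$ into a graph $H$ is an injective map $V(T)\to V(H)$ sending edges of $T$ to edges of $H$. $\log$ denotes the natural logarithm. *)

(* Defs.v *)
From HB Require Import structures.
From mathcomp Require Import all_boot all_order all_algebra.
From mathcomp Require Import reals exp.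

Set Implicit Arguments.
Unset Strict Implicit.
Unset Printing Implicit Defensive.

Import Order.TTheory GRing.Theory Num.Theory.

Record sgraph (V : finType) := SGraph {
  adj :> rel V;
  adj_sym : symmetric adj;
  adj_irrefl : irreflexive adj }.

Definition degree (V : finType) (G : sgraph V) (u : V) : nat :=
  #|[set w | G u w]|.

Definition max_degree (V : finType) (G : sgraph V) : nat :=
  \max_(u : V) degree G u.

(* Every degree is smaller than #|V|, so the default value #|V| only matters
   when V is empty. *)
Definition min_degree (V : finType) (G : sgraph V) : nat :=
  \big[minn/#|V|]_(u : V) degree G u.

Definition edges (V : finType) (G : sgraph V) : {set {set V}} :=
  [set [set u.1; u.2] | u : V * V & G u.1 u.2].

(* The bound 2 < size c excludes the closed walks u, w, u along one edge. *)
Definition acyclic (V : finType) (G : sgraph V) : Prop :=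
  forall c : seq V, 2 < size c -> ~ ucycle G c.

Definition connected (V : finType) (G : sgraph V) : Prop :=
  0 < #|V| /\ forall u w : V, connect G u w.

Definition is_tree (V : finType) (G : sgraph V) : Prop :=
  connected G /\ acyclic G.

Section EdgeGraph.
Variables (V : finType) (F : {set {set V}}).

Definition edge_rel : rel V := [rel u w | (u != w) && ([set u; w] \in F)].

Lemma edge_rel_sym : symmetric edge_rel.
Proof. by move=> u w; rewrite /edge_rel /= eq_sym setUC. Qed.

Lemma edge_rel_irrefl : irreflexive edge_rel.
Proof. by move=> u; rewrite /edge_rel /= eqxx. Qed.

Definition edge_graph : sgraph V := SGraph edge_rel_sym edge_rel_irrefl.

End EdgeGraph.

Definition is_embedding (W V : finType) (T : sgraph W) (H : sgraph V)
    (f : {ffun W -> V}) : bool :=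
  injectiveb f && [forall u, forall w, T u w ==> H (f u) (f w)].

Local Open Scope ring_scope.

(* The probability that G_p satisfies A: the law of the edge set F of G_p is
   the product over the edges of G of Bernoulli(p) laws. *)
Definition random_subgraph_prob (R : realType) (V : finType) (G : sgraph V)
    (p : R) (A : pred (sgraph V)) : R :=
  \sum_(F : {set {set V}} | (F \subset edges G) && A (edge_graph F))
    \prod_(e in edges G) (if e \in F then p else 1 - p).

(* Main.v *)
Require Import Defs.
From HB Require Import structures.
From mathcomp Require Import all_boot all_order all_algebra fingroup perm.
From mathcomp Require Import reals exp.
From mathcomp Require Import zify ring lra.

(* The uniform distribution on the embeddings f of T into G with f v = x is
   spread, and a spread family of edge sets is hit by a sparse random set.

   Spreadness. Write d for the maximal number of non-neighbours in G.
   Exchanging the images of a and c turns an embedding into another one unless c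
   is one of about 2 Delta d = O(n / (log n)^5) bad vertices. Such exchanges
   repair the bad edges of an arbitrary bijection, and comparing the embeddings
   with f a = y to their exchanges shows that fixing one more value of f divides
   the number of embeddings by at least n / log n, except for the last O(n / log n)
   values, whose total cost is only exp(O(n)). Hence k prescribed values have
   probability at most (C log n / n)^k. A set U of edges of G is the image of a
   set of edges of T in at most n^(m - |U|) Delta^|U| ways, m being the number
   of its vertices other than x (peel off leaves), so U lies in the image of T
   with probability at most (Delta C^2 (log n)^2 / n)^|U|.

   Sparse random sets (Park and Pham's fragments). Expose the random edge set in
   O(log n) rounds. Each round replaces a hyperedge S by the smallest part outside
   the exposed set of a hyperedge contained in the union of S with that set. The
   parts that remain large have small expected cost, and spreadness says that no
   cover of the hypergraph is cheap, so some hyperedge is eventually exposed with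
   probability at least 1/2. Independent repetitions bring the failure probability
   below n^-3. *)

Set Implicit Arguments.
Unset Strict Implicit.
Unset Printing Implicit Defensive.

Import Order.TTheory GRing.Theory Num.Theory.
Local Open Scope ring_scope.

(** * Random subsets and spread hypergraphs *)

Section RandomSubset.
Variables (R : realFieldType) (X : finType).
Implicit Types (p : R) (E F : {set X}) (phi psi : {set X} -> R).

(** The product weighting [F] in [random_subgraph_prob], over an arbitrary ground set [E]. *)
Definition bern_weight p E F : R :=
  \prod_(e in E) (if e \in F then p else 1 - p).

Definition bern_exp p E phi : R :=
  \sum_(F : {set X} | F \subset E) bern_weight p E F * phi F.

Lemma bern_weight_ge0 p E F : 0 <= p <= 1 -> 0 <= bern_weight p E F.
Proof.
move=> /andP[p0 p1]; apply: prodr_ge0 => e _.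
by case: ifP => _ //; rewrite subr_ge0.
Qed.

Lemma eq_bern_exp p E phi psi :
  (forall F, F \subset E -> phi F = psi F) -> bern_exp p E phi = bern_exp p E psi.
Proof. by move=> h; apply: eq_bigr => F FE; rewrite h. Qed.

Lemma ler_bern_exp p E phi psi : 0 <= p <= 1 ->
  (forall F, F \subset E -> phi F <= psi F) -> bern_exp p E phi <= bern_exp p E psi.
Proof.
move=> hp h; apply: ler_sum => F FE.
by apply: ler_wpM2l; [exact: bern_weight_ge0 | exact: h].
Qed.

Lemma bern_expD p E phi psi :
  bern_exp p E (fun F => phi F + psi F) = bern_exp p E phi + bern_exp p E psi.
Proof.
by rewrite /bern_exp -big_split /=; apply: eq_bigr => F _; rewrite mulrDr.
Qed.

Lemma bern_expZ p E a phi :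
  bern_exp p E (fun F => a * phi F) = a * bern_exp p E phi.
Proof.
by rewrite /bern_exp mulr_sumr; apply: eq_bigr => F _; rewrite mulrCA.
Qed.

Lemma bern_exp_set0 p phi : bern_exp p set0 phi = phi set0.
Proof.
rewrite /bern_exp (bigD1 set0) ?sub0set //= big1 => [|F /andP[]].
  by rewrite /bern_weight big_set0 mul1r addr0.
by rewrite subset0 => ->.
Qed.

(** Conditioning on whether [e] is kept; this reduces identities for product measures to induction
    on [E]. *)
Lemma bern_expU1 p E e phi : e \notin E ->
  bern_exp p (e |: E) phi =
  p * bern_exp p E (fun F => phi (e |: F)) + (1 - p) * bern_exp p E phi.
Proof.
move=> eE; rewrite /bern_exp (bigID (fun F : {set X} => e \in F)) /=.
congr (_ + _); rewrite mulr_sumr.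
- rewrite (reindex_onto (fun F => e |: F) (fun F => F :\ e)) /=; last first.
    by move=> F /andP[_ eF]; rewrite setD1K.
  apply: eq_big => [F|F].
    rewrite setU11 andbT; apply/andP/idP => [[h /eqP he]|FE].
      apply/subsetP => y yF; have := subsetP h y; rewrite !inE yF orbT.
      move=> /(_ isT) /orP[/eqP ye|//].
      by move: yF; rewrite -he !inE ye eqxx.
    have eF : e \notin F by apply: contra eE; exact: (subsetP FE).
    by rewrite setUS // setU1K.
  move=> /andP[/andP[h _] /eqP he]; rewrite mulrA; congr (_ * _).
  rewrite /bern_weight big_setU1 //= setU11; congr (_ * _).
  apply: eq_bigr => y yE; rewrite !inE; case: eqP => [ye|//].
  by rewrite ye (negbTE eE) in yE.
- apply: eq_big => [F|F].
    by rewrite -[in RHS](setU1K eE) subsetD1.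
  move=> /andP[FE eF]; rewrite mulrA; congr (_ * _).
  by rewrite /bern_weight big_setU1 //= (negbTE eF).
Qed.

Lemma set_ind (P : {set X} -> Prop) : P set0 ->
  (forall e E, e \notin E -> P E -> P (e |: E)) -> forall E, P E.
Proof.
move=> P0 PS E; have [k] := ubnP #|E|; elim: k E => // k IH E hE.
have [->|[e eE]] := set_0Vmem E; first exact: P0.
rewrite -(setD1K eE); apply: PS; first by rewrite !inE eqxx.
by apply: IH; move: hE; rewrite (cardsD1 e) eE.
Qed.

Lemma bern_exp_cst p E c : bern_exp p E (fun=> c) = c.
Proof.
elim/set_ind: E => [|e E eE IH]; first by rewrite bern_exp_set0.
by rewrite bern_expU1 // IH; ring.
Qed.

(** An element escapes two independent exposures with probability (1 - p1)(1 - p2). This is what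
    allows exposure in rounds. *)
Lemma bern_exp_union p1 p2 E phi :
  bern_exp p1 E (fun F1 => bern_exp p2 E (fun F2 => phi (F1 :|: F2))) =
  bern_exp (p1 + p2 - p1 * p2) E phi.
Proof.
elim/set_ind: E phi => [|e E eE IH] phi.
  by rewrite !bern_exp_set0 setU0.
pose psi F := phi (e |: F).
have A F1 : bern_exp p2 (e |: E) (fun F2 => phi (e |: F1 :|: F2)) =
            bern_exp p2 E (fun F2 => psi (F1 :|: F2)).
  rewrite bern_expU1 // /psi.
  rewrite (@eq_bern_exp _ _ (fun F2 => phi (e |: F1 :|: (e |: F2)))
    (fun F2 => phi (e |: (F1 :|: F2)))) => [|F2 _]; last by rewrite setUACA setUid.
  rewrite (@eq_bern_exp _ _ (fun F2 => phi (e |: F1 :|: F2))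
    (fun F2 => phi (e |: (F1 :|: F2)))) => [|F2 _]; last by rewrite setUA.
  by ring.
have B F1 : bern_exp p2 (e |: E) (fun F2 => phi (F1 :|: F2)) =
    p2 * bern_exp p2 E (fun F2 => psi (F1 :|: F2)) +
    (1 - p2) * bern_exp p2 E (fun F2 => phi (F1 :|: F2)).
  rewrite bern_expU1 // /psi; congr (_ * _ + _).
  by apply: eq_bern_exp => F2 _; rewrite setUCA.
rewrite !bern_expU1 // (eq_bern_exp _ (fun F1 _ => A F1)) (eq_bern_exp _ (fun F1 _ => B F1)).
rewrite bern_expD !bern_expZ (IH phi) (IH psi).
by ring.
Qed.

Lemma bern_exp_anti p p' E phi : 0 <= p -> p <= p' -> p' <= 1 ->
  (forall F F' : {set X}, F \subset F' -> phi F' <= phi F) ->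
  bern_exp p' E phi <= bern_exp p E phi.
Proof.
move=> p0 pp' p'1 mono.
have [p1|p1] := eqVneq p 1; first by have -> : p' = p by lra.
have p1' : p < 1 by rewrite lt_neqAle p1 (le_trans pp').
(* [r] solves 1 - p' = (1 - p)(1 - r): a [p']-random set is a [p]-random set enlarged by an
   independent [r]-random one. *)
pose r := (p' - p) / (1 - p).
have r01 : 0 <= r <= 1.
  by rewrite /r divr_ge0 ?subr_ge0 ?(ltW p1') //= ler_pdivrMr ?subr_gt0 //; lra.
have -> : p' = p + r - p * r by rewrite /r; field; rewrite subr_eq0 eq_sym.
rewrite -bern_exp_union; apply: ler_bern_exp; first by rewrite p0 ltW.
move=> F _; rewrite -[leRHS](bern_exp_cst r E); apply: ler_bern_exp => // F2 _.
by apply: mono; rewrite subsetUl.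
Qed.

End RandomSubset.

(** * Covers, fragments and repeated exposure *)

Section Spread.
Variables (R : realFieldType) (X : finType).
Implicit Types (p q : R) (E F S U W Z : {set X}) (H C : {set {set X}}).

Definition misses H F : R := (~~ [exists S in H, S \subset F])%:R.

Definition covers C H := [forall S in H, [exists U in C, U \subset S]].

Definition cost q C : R := \sum_(U in C) q ^+ #|U|.

Lemma misses_ge0 H F : 0 <= misses H F.
Proof. by rewrite /misses ler0n. Qed.

Lemma misses_le1 H F : misses H F <= 1.
Proof. by rewrite /misses -[leRHS]/(1%:R) ler_nat leq_b1. Qed.

Lemma misses_anti H F F' : F \subset F' -> misses H F' <= misses H F.
Proof.
move=> FF'; rewrite /misses ler_nat.
case: (boolP [exists S in H, S \subset F']) => //=.
rewrite negb_exists => /forallP h.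
have -> // : [exists S in H, S \subset F] = false.
apply/negbTE; rewrite negb_exists; apply/forallP => S.
by have := h S; apply: contra => /andP[-> /subset_trans->].
Qed.

(** The [S] after [<] is the default of the arg min; it is itself admissible when [S] lies in
    [H]. *)
Definition fragment H W S : {set X} :=
  [arg min_(S' < S | (S' \in H) && (S' \subset W :|: S)) #|S' :\: W|] :\: W.

Variant fragment_spec H W S : {set X} -> Prop :=
  FragmentSpec S' of S' \in H & S' \subset W :|: S &
    (forall S'', S'' \in H -> S'' \subset W :|: S -> #|S' :\: W| <= #|S'' :\: W|)%N :
  fragment_spec H W S (S' :\: W).

Lemma fragmentP H W S : S \in H -> fragment_spec H W S (fragment H W S).
Proof.
move=> SH; rewrite /fragment; case: arg_minnP => [|S' /andP[S'H S'W] min].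
  by rewrite SH subsetUr.
by split=> // S'' h1 h2; apply: min; rewrite h1.
Qed.

Definition small_fragments h H W := [set fragment H W S | S in H & (#|fragment H W S| <= h)%N].
Definition large_fragments h H W := [set fragment H W S | S in H & (h < #|fragment H W S|)%N].

(** The fragment of [S] lies inside [S], so whatever covers the fragment covers [S]; a large
    fragment serves as its own cover. *)
Lemma covers_fragments h H W C : covers C (small_fragments h H W) ->
  covers (C :|: large_fragments h H W) H.
Proof.
move=> /forall_inP cov; apply/forall_inP => S SH.
have sub : fragment H W S \subset S.
  by case: fragmentP => // S' _ + _; rewrite subDset.
case: (leqP #|fragment H W S| h) => hS.
  have /cov/exists_inP[U UC US] : fragment H W S \in small_fragments h H W.
    by apply/imsetP; exists S => //; rewrite inE SH.
  by apply/exists_inP; exists U; rewrite ?inE ?UC // (subset_trans US).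
apply/exists_inP; exists (fragment H W S) => //.
by rewrite inE; apply/orP; right; apply/imsetP; exists S => //; rewrite inE SH.
Qed.

Lemma costU q C C' : 0 <= q -> cost q (C :|: C') <= cost q C + cost q C'.
Proof.
move=> q0; rewrite /cost.
rewrite (bigID (mem C)) /=; apply: lerD.
  rewrite le_eqVlt; apply/orP; left; apply/eqP; apply: eq_bigl => U /=.
  by rewrite inE; case: (U \in C); rewrite ?andbF.
rewrite [leRHS](bigID (mem C)) /= -[leLHS]add0r; apply: lerD.
  by apply: sumr_ge0 => U _; rewrite exprn_ge0.
rewrite le_eqVlt; apply/orP; left; apply/eqP; apply: eq_bigl => U /=.
by rewrite inE; case: (U \in C); rewrite ?andbF ?andbT.
Qed.

(** A set containing [S' :\: W] completes the hyperedge [S'] once [W] is added. *)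
Lemma misses_small_fragments h H W F :
  misses H (W :|: F) <= misses (small_fragments h H W) F.
Proof.
rewrite /misses ler_nat.
case: (boolP [exists S in H, S \subset W :|: F]) => //=; rewrite negb_exists => /forallP hn.
have -> // : [exists S in small_fragments h H W, S \subset F] = false.
apply/negbTE; rewrite negb_exists; apply/forallP => U; apply/negP => /andP[].
move=> /imsetP[S]; rewrite inE => /andP[SH _] ->; case: fragmentP => // S' S'H _ _ S'F.
by have := hn S'; rewrite S'H /= -subDset S'F.
Qed.

(** Adding [U] replaces its factors, which are at most 1, by [p]. *)
Lemma bern_weight_setU p E W U : 0 <= p <= 1 -> U \subset E -> [disjoint U & W] ->
  bern_weight p E W * p ^+ #|U| <= bern_weight p E (W :|: U).
Proof.
move=> /andP[p0 p1] UE dUW.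
have EU : E :&: U = U by apply/setIidPr.
rewrite /bern_weight [in leLHS](big_setID U) [in leRHS](big_setID U) /= !EU.
have e1 : \prod_(i in E :\: U) (if i \in W :|: U then p else 1 - p) =
          \prod_(i in E :\: U) (if i \in W then p else 1 - p).
  by apply: eq_bigr => i; rewrite !inE => /andP[/negbTE-> _]; rewrite orbF.
have e2 : \prod_(i in U) (if i \in W :|: U then p else 1 - p) = p ^+ #|U|.
  rewrite (eq_bigr (fun=> p)) ?prodr_const // => i iU.
  by rewrite inE iU orbT.
rewrite e1 e2 mulrC; apply: ler_wpM2l; first exact: exprn_ge0.
apply: ler_piMl.
  by apply: prodr_ge0 => i _; case: ifP => _; lra.
by apply: prodr_ile1 => i _; case: ifP => _; lra.
Qed.

Lemma setUDK Z U : U \subset Z -> Z :\: U :|: U = Z.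
Proof. by move=> /setIidPr UZ; rewrite -{2}UZ setUC setID. Qed.

(* A pair [(W, U)] is recovered from [Z = W :|: U] and [U]; minimality forces
   [U] into any hyperedge contained in [Z], so given [Z] there are at most [2 ^ k]
   choices of [U]. *)
Lemma exp_cost_large p q E h k H : 0 < p <= 1 -> 0 <= q <= p ->
  (forall S, S \in H -> S \subset E) -> (forall S, S \in H -> #|S| <= k)%N ->
  bern_exp p E (fun W => cost q (large_fragments h H W)) <=
  2 ^+ k * (q / p) ^+ h.+1.
Proof.
move=> /andP[p0 p1] /andP[q0 qp] HE Hk.
have p01 : 0 <= p <= 1 by rewrite ltW.
have qp0 : 0 <= q / p by rewrite divr_ge0 // ltW.
have lp W U : U \in large_fragments h H W ->
    [/\ (h < #|U|)%N, U \subset E, [disjoint U & W],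
     [exists S in H, S \subset W :|: U] &
     forall S, S \in H -> S \subset W :|: U -> U \subset S].
  move=> /imsetP[S]; rewrite inE => /andP[SH hS] eU; split; first by rewrite eU.
  - rewrite eU; case: fragmentP => // S' S'H _ _.
    by rewrite (subset_trans (subsetDl _ _)) ?HE.
  - rewrite eU; case: fragmentP => // S' S'H _ _.
    by rewrite -setI_eq0 setIDAC setDIl setDv setI0.
  - rewrite eU; case: fragmentP => // S' S'H _ _.
    by apply/exists_inP; exists S'; rewrite // -subDset.
  - rewrite eU; case: fragmentP => // S' S'H S'WS min S2 S2H S2W.
    have S2S : S2 \subset W :|: S.
      apply: subset_trans S2W _; rewrite subUset subsetUl /=.
      by rewrite (subset_trans (subsetDl _ _)).
    (* Minimality turns this inclusion into an equality. *)
    have sub : S2 :\: W \subset S' :\: W.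
      rewrite subDset; apply: subset_trans S2W _.
      by apply: setUSS.
    have/eqP <- : S2 :\: W == S' :\: W by rewrite eqEcard sub min.
    exact: subsetDl.
pose pr Z U := (U \subset Z) && (U \in large_fragments h H (Z :\: U)).
(* Change of variables from [W] to [Z = W :|: U]; the weight gained, at most p ^- #|U|, turns [q]
   into [q / p]. *)
have step1 : bern_exp p E (fun W => cost q (large_fragments h H W)) <=
   bern_exp p E (fun Z => \sum_(U : {set X} | pr Z U) (q / p) ^+ #|U|).
  rewrite /bern_exp /cost.
  under eq_bigr do rewrite mulr_sumr.
  under [leRHS]eq_bigr do rewrite mulr_sumr.
  rewrite (exchange_big_dep xpredT) //= [leRHS](exchange_big_dep xpredT) //=.
  apply: ler_sum => U _.
  have [UE|UE] := boolP (U \subset E); last first.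
    rewrite big1 => [|W /andP[_ /lp[_]]]; last by rewrite (negbTE UE).
    by apply: sumr_ge0 => Z _; rewrite mulr_ge0 ?bern_weight_ge0 ?exprn_ge0.
  rewrite [leRHS](reindex_onto (fun W => W :|: U) (fun Z => Z :\: U)) /=; last first.
    by move=> Z /andP[_ /andP[UZ _]]; rewrite setUDK.
  rewrite [leRHS](eq_bigl (fun W => (W \subset E) && (U \in large_fragments h H W))).
    apply: ler_sum => W /andP[WE /lp[_ _ dUW _ _]].
    rewrite expr_div_n mulrA ler_pdivlMr ?exprn_gt0 // mulrAC.
    by rewrite ler_wpM2r ?exprn_ge0 // bern_weight_setU.
  move=> W; rewrite /pr subUset UE subsetUr !andbT setDUl setDv setU0 /=.
  apply/andP/andP => [[/andP[-> hU] /eqP e]|[-> hU]].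
    by rewrite e in hU.
  have [_ _ dUW _ _] := lp _ _ hU.
  have e : W :\: U = W by apply/setDidPl; rewrite disjoint_sym.
  by split; rewrite e ?hU.
apply: le_trans step1 _.
rewrite -[leRHS](bern_exp_cst p E).
apply: ler_bern_exp => // Z ZE.
have [/exists_inP[S SH SZ]|no] := boolP [exists S in H, S \subset Z]; last first.
  rewrite big1 => [|U /andP[UZ /lp[_ _ _ + _]]].
    by rewrite mulr_ge0 ?exprn_ge0.
  by rewrite setUDK // (negbTE no).
apply: (@le_trans _ _ (\sum_(U in powerset S) (q / p) ^+ h.+1)); last first.
  rewrite sumr_const card_powerset -[leLHS]mulr_natl natrX ler_wpM2r //.
    by rewrite exprn_ge0.
  by rewrite ler_eXn2l ?ltr1n // Hk.
rewrite [leRHS](bigID (pr Z)) /= -[leLHS]addr0; apply: lerD; last first.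
  by apply: sumr_ge0 => U _; rewrite exprn_ge0.
rewrite [leRHS](eq_bigl (pr Z)) => [|U].
  apply: ler_sum => U /andP[_ /lp[hU _ _ _ _]].
  rewrite ler_wiXn2l //.
  by rewrite ler_pdivrMr // mul1r.
rewrite powersetE andbC; case: (boolP (pr Z U)) => //= /andP[UZ /lp[_ _ _ _]].
by rewrite setUDK // => ->.
Qed.

(* After a round with density [16 * q] the fragments of size at least [2 ^ j] cost
   at most [2 ^- j.+2]; the remaining ones are handled by induction, their covers
   being cheaper than [theta] by no more than that cost. *)
Lemma misses_bound q E j H theta P : 0 < q ->
  (forall S, S \in H -> S \subset E) -> (forall S, S \in H -> #|S| < 2 ^ j)%N ->
  (forall C, covers C H -> theta <= cost q C) ->
  j%:R * (16 * q) <= P <= 1 ->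
  bern_exp P E (misses H) <= 1 - theta + 2^-1 * (1 - 2 ^- j).
Proof.
move=> q0; elim: j H theta P => [|j IH] H theta P HE Hj Hc /andP[hP P1].
  have P0 : 0 <= P by apply: le_trans hP; rewrite mul0r.
  rewrite expr0 invr1 subrr mulr0 addr0.
  have [t0|t0] := lerP theta 0.
    apply: (@le_trans _ _ 1); last by lra.
    rewrite -[leRHS](bern_exp_cst P E); apply: ler_bern_exp; first by rewrite P0.
    by move=> F _; exact: misses_le1.
  (* [H] is nonempty, as otherwise the empty cover would cost 0; its members have fewer than 2 ^ 0
     elements. *)
  have H0 : set0 \in H.
    case: (set_0Vmem H) => [H0|[S SH]].
      have cov : covers set0 H by apply/forall_inP => S; rewrite H0 inE.
      by have := Hc _ cov; rewrite /cost big_set0 leNgt t0.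
    by have := Hj S SH; rewrite expn0 ltnS leqn0 cards_eq0 => /eqP <-.
  have t1 : theta <= 1.
    have : covers [set set0] H.
      by apply/forall_inP => S _; apply/exists_inP; exists set0; rewrite ?inE ?sub0set.
    by move=> /Hc; rewrite /cost big_set1 cards0 expr0.
  rewrite (@eq_bern_exp _ _ _ _ _ (fun=> 0)) ?bern_exp_cst ?subr_ge0 // => F _.
  rewrite /misses; suff -> : [exists S in H, S \subset F] by [].
  by apply/exists_inP; exists set0; rewrite ?sub0set.
pose p1 := 16 * q; pose P' := j%:R * (16 * q).
have e1 : P' + p1 = j.+1%:R * (16 * q) by rewrite -natr1 mulrDl mul1r.
have p10 : 0 < p1 by rewrite mulr_gt0.
have P'0 : 0 <= P' by rewrite mulr_ge0 // ltW.
have p1le : p1 <= 1 by lra.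
have P'le : P' <= 1 by lra.
have p1P' : 0 <= p1 * P' <= p1 by rewrite mulr_ge0 ?(ltW p10) //= ler_piMr // ltW.
apply: (@le_trans _ _ (bern_exp (p1 + P' - p1 * P') E (misses H))).
  by apply: bern_exp_anti; [lra|lra|lra|exact: misses_anti].
rewrite -bern_exp_union.
pose h := (2 ^ j).-1.
have hh : h.+1 = (2 ^ j)%N by rewrite prednK // expn_gt0.
have p101 : 0 <= p1 <= 1 by rewrite ltW.
apply: (@le_trans _ _ (bern_exp p1 E (fun W =>
    (1 - theta + 2^-1 * (1 - 2 ^- j)) + cost q (large_fragments h H W)))).
  apply: ler_bern_exp => // W WE.
  apply: (@le_trans _ _ (bern_exp P' E (misses (small_fragments h H W)))).
    apply: ler_bern_exp; first by rewrite P'0.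
    by move=> F _; exact: misses_small_fragments.
  apply: le_trans (IH _ (theta - cost q (large_fragments h H W)) _ _ _ _ _) _.
  - move=> U /imsetP[S]; rewrite inE => /andP[SH _] ->; case: fragmentP => // S' S'H _ _.
    by rewrite (subset_trans (subsetDl _ _)) // HE.
  - by move=> U /imsetP[S]; rewrite inE => /andP[SH hS] ->; rewrite -hh ltnS.
  - move=> C /covers_fragments/Hc hC; rewrite lerBlDr (le_trans hC) //.
    by apply: costU; rewrite ltW.
  - by rewrite lexx.
  - by rewrite /=; lra.
rewrite bern_expD bern_exp_cst.
have Hk S : S \in H -> (#|S| <= 2 ^ j.+1)%N by move=> SH; exact: ltnW (Hj S SH).
have c1 : bern_exp p1 E (fun W => cost q (large_fragments h H W)) <=
   2 ^+ (2 ^ j.+1) * (q / p1) ^+ h.+1.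
  apply: exp_cost_large => //; first by rewrite p10.
  by rewrite ltW //= /p1; lra.
(* As q / p1 = 2 ^- 4 and h.+1 = 2 ^ j, the exponent of 2 is 2 * 2 ^ j - 4 * 2 ^ j = - 2 ^ j.+1. *)
have c2 : 2 ^+ (2 ^ j.+1) * (q / p1) ^+ h.+1 <= 2 ^- j.+2 :> R.
  have -> : q / p1 = 2 ^- 4.
    by rewrite /p1; field; rewrite gt_eqF.
  rewrite -exprVn -exprM hh expnS exprVn ler_pdivrMr ?exprn_gt0 //.
  rewrite mulrC ler_pdivlMr ?exprn_gt0 // -exprD ler_eXn2l ?ltr1n //.
  have := ltn_expl j (ltnSn 1); lia.
have c3 : 2^-1 * (1 - 2 ^- j.+1) = 2^-1 * (1 - 2 ^- j) + 2 ^- j.+2 :> R.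
  have : (2 ^+ j : R) != 0 by rewrite expf_neq0 ?pnatr_eq0.
  by move=> z; rewrite !exprS; move: z; set y := 2 ^+ j => z; field; rewrite ?z.
by rewrite c3 addrA; apply: lerD => //; apply: le_trans c1 c2.
Qed.

(** A union of [r] independent [P]-random sets misses [H] only if each of them does. *)
Lemma misses_iter P P' E H r : 0 <= P <= 1 -> bern_exp P E (misses H) <= 2^-1 ->
  r%:R * P <= P' <= 1 -> bern_exp P' E (misses H) <= 2 ^- r.
Proof.
move=> /andP[P0 P1] hP; elim: r P' => [|r IH] P' /andP[hP' P'1].
  have P'0 : 0 <= P' by apply: le_trans hP'; rewrite mul0r.
  rewrite expr0 invr1 -[leRHS](bern_exp_cst P' E); apply: ler_bern_exp; first by rewrite P'0.
  by move=> F _; exact: misses_le1.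
pose Q := r%:R * P.
have Q0 : 0 <= Q by rewrite mulr_ge0.
have e1 : P + Q = r.+1%:R * P by rewrite -natr1 mulrDl mul1r addrC.
have QP : 0 <= P * Q <= P by rewrite mulr_ge0 //= ler_piMr //; lra.
apply: (@le_trans _ _ (bern_exp (P + Q - P * Q) E (misses H))).
  by apply: bern_exp_anti; [lra|lra|lra|exact: misses_anti].
rewrite -bern_exp_union.
apply: (@le_trans _ _ (bern_exp P E (fun F => 2 ^- r * misses H F))).
  apply: ler_bern_exp; first by rewrite P0.
  move=> F1 _.
  apply: (@le_trans _ _ (bern_exp Q E (fun F2 => misses H F1 * misses H F2))).
    apply: ler_bern_exp; first by rewrite Q0 /=; lra.
    move=> F2 _; have := misses_anti H (subsetUl F1 F2); have := misses_anti H (subsetUr F1 F2).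
    rewrite /misses -natrM !ler_nat; do !case: (~~ _) => //.
  rewrite bern_expZ mulrC ler_wpM2r ?misses_ge0 //.
  by apply: IH; rewrite lexx /= /Q; lra.
rewrite bern_expZ exprS invfM mulrC ler_wpM2r //.
by rewrite invr_ge0 exprn_ge0.
Qed.

End Spread.

(** * Exchanging two images of an embedding *)

Lemma card_bigcup_sum (I X : finType) (B : {set I}) (F : I -> {set X}) :
  (#|\bigcup_(i in B) F i| <= \sum_(i in B) #|F i|)%N.
Proof.
elim/big_ind2: _ => [|m X1 k X2 h1 h2|//]; first by rewrite cards0.
by apply: leq_trans (leq_add h1 h2); rewrite cardsU leq_subr.
Qed.

Lemma card_bigcup_le (I X : finType) (B : {set I}) (F : I -> {set X}) k :
  (forall i, i \in B -> #|F i| <= k)%N -> (#|\bigcup_(i in B) F i| <= #|B| * k)%N.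
Proof.
move=> h; apply: leq_trans (card_bigcup_sum B F) _.
by rewrite -sum_nat_const; apply: leq_sum.
Qed.

Section Swap.
Local Open Scope nat_scope.
Variables (W V : finType) (T : sgraph W) (G : sgraph V) (v : W) (x : V) (d : nat).
Hypothesis cardWV : #|W| = #|V|.
Hypothesis hd : forall y, #|[set z | ~~ G y z]| <= d.
Implicit Types (f : {ffun W -> V}) (a c : W) (A : {set W}).

Let Delta := max_degree T.

(** A good [c] is never adjacent to [a] in [T]: the case [u = c] would require a loop at [f c]. *)
Definition good_swaps f a := [set c | [&& c != a,
  [forall u, T a u ==> G (f c) (f u)] & [forall u, T c u ==> G (f a) (f u)]]].

Definition swap f a c : {ffun W -> V} := [ffun u => f (tperm a c u)].

Definition bad_edges f := [set e : W * W | T e.1 e.2 && ~~ G (f e.1) (f e.2)].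

Lemma is_embeddingE f : is_embedding T G f = injectiveb f && (bad_edges f == set0).
Proof.
rewrite /is_embedding; congr (_ && _).
apply/forallP/eqP => [h|h u].
  apply/setP => -[u w]; rewrite !inE /=.
  by have /forallP/(_ w) := h u; case: (T u w) => //= ->.
apply/forallP => w; apply/implyP => uw.
by move/setP/(_ (u, w)): h; rewrite !inE /= uw => /negbFE.
Qed.

Lemma swap_inj f a c : injective f -> injective (swap f a c).
Proof. by move=> fi u w; rewrite !ffunE => /fi /perm_inj. Qed.

(** Edges at [a] or [c] become good by the choice of [c], and all others keep their image. As [f]
    may have bad edges, exchanges can also repair it. *)
Lemma swap_bad_edges f a c e : c \in good_swaps f a -> e \in bad_edges (swap f a c) ->
  [/\ e \in bad_edges f, e.1 != a & e.2 != a].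
Proof.
rewrite !inE => /and3P[ca /forallP ha /forallP hc] /andP[]; case: e => u w /=.
have nac : ~~ T a c.
  by apply/negP => ac; have := ha c; rewrite ac adj_irrefl.
have nca : ~~ T c a by rewrite adj_sym.
have tpD z : z != a -> z != c -> tperm a c z = z.
  by move=> za zc; rewrite tpermD // eq_sym.
have key z z' : T z z' -> (z == a) || (z == c) ->
    G (f (tperm a c z)) (f (tperm a c z')).
  move=> zz' /orP[/eqP za|/eqP zc].
    subst z; have z'a : z' != a by apply: contraTneq zz' => ->; rewrite adj_irrefl.
    have z'c : z' != c by apply: contraTneq zz' => ->.
    by rewrite tpermL tpD //; have := ha z'; rewrite zz'.
  subst z; have z'a : z' != c by apply: contraTneq zz' => ->; rewrite adj_irrefl.
  have z'c : z' != a by apply: contraTneq zz' => ->.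
  by rewrite tpermR tpD //; have := hc z'; rewrite zz'.
rewrite !ffunE => uw nG.
have nu : ~~ ((u == a) || (u == c)) by apply: contra nG; exact: key.
have nw : ~~ ((w == a) || (w == c)).
  by apply: contra nG => hw; rewrite adj_sym; apply: key => //; rewrite adj_sym.
move: nu nw nG; rewrite !negb_or => /andP[ua uc] /andP[wa wc].
by rewrite !tpD // => ->; rewrite uw.
Qed.

Lemma swap_embedding f a c : is_embedding T G f -> c \in good_swaps f a ->
  is_embedding T G (swap f a c).
Proof.
rewrite !is_embeddingE => /andP[/injectiveP fi /eqP f0] hc.
apply/andP; split; first by apply/injectiveP; exact: swap_inj.
apply/eqP/setP => e; rewrite [RHS]inE; apply/negP => he.
by have [+ _ _] := swap_bad_edges hc he; rewrite f0 inE.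
Qed.

Lemma degree_le_max u : degree T u <= Delta.
Proof. exact: leq_bigmax. Qed.

Lemma card_nonadj f y : injective f -> #|[set u | ~~ G y (f u)]| <= d.
Proof.
move=> fi; rewrite -(card_imset _ fi); apply: leq_trans (hd y); apply: subset_leq_card.
by apply/subsetP => z /imsetP[u]; rewrite !inE => h ->.
Qed.

(** A bad [c] is [a], or [f c] misses the image of a neighbour of [a], or [c] has a neighbour whose
    image [f a] misses. *)
Lemma card_bad_swaps f a : injective f ->
  #|~: good_swaps f a| <= 1 + 2 * (Delta * d).
Proof.
move=> fi.
pose B1 := \bigcup_(u in [set u | T a u]) [set c | ~~ G (f u) (f c)].
pose B2 := \bigcup_(u in [set u | ~~ G (f a) (f u)]) [set c | T u c].
have c1 : #|B1| <= Delta * d.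
  apply: leq_trans (card_bigcup_le (k := d) _) _ => [u _|]; first exact: card_nonadj.
  by rewrite leq_mul2r degree_le_max orbT.
have c2 : #|B2| <= Delta * d.
  apply: leq_trans (card_bigcup_le (k := Delta) _) _ => [u _|]; first exact: degree_le_max.
  by rewrite mulnC leq_mul2l card_nonadj // orbT.
have sub : ~: good_swaps f a \subset a |: (B1 :|: B2).
  apply/subsetP => c; rewrite !inE !negb_and negbK.
  case/or3P=> [-> //|/forallPn[u]|/forallPn[u]]; rewrite negb_imply => /andP[h1 h2].
    by apply/orP; right; apply/orP; left; apply/bigcupP; exists u; rewrite inE // adj_sym.
  by apply/orP; right; apply/orP; right; apply/bigcupP; exists u; rewrite inE // adj_sym.
apply: leq_trans (subset_leq_card sub) _; rewrite cardsU1.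
have := leq_subr #|B1 :&: B2| (#|B1| + #|B2|); rewrite -cardsU.
by case: (_ \notin _); lia.
Qed.

Definition rooted_embeddings := [set f | is_embedding T G f && (f v == x)].

Lemma card_good_swaps f a A : injective f ->
  #|V| - (#|A| + (1 + 2 * (Delta * d))) <= #|good_swaps f a :\: A|.
Proof.
move=> fi; have := card_bad_swaps a fi; have := cardsC (good_swaps f a).
rewrite cardWV => h1 h2; rewrite cardsD.
have := subset_leq_card (subsetIr (good_swaps f a) A); lia.
Qed.

(** Take a bijection with [f v = x] and the fewest bad edges. A bad edge has an end [a] other than
    [v]; a good exchange of [a] with some [c] other than [v] removes it and creates none. *)
Lemma rooted_embeddings_neq0 : 2 + 2 * (Delta * d) < #|V| -> rooted_embeddings != set0.
Proof.
move=> hn.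
have [f0 f0i f0v] : exists2 f0 : {ffun W -> V}, injective f0 & f0 v = x.
  pose g u := enum_val (cast_ord cardWV (enum_rank u)) : V.
  have gi : injective g by move=> u w /enum_val_inj/cast_ord_inj/enum_rank_inj.
  exists [ffun u => tperm (g v) x (g u)]; last by rewrite ffunE tpermL.
  by move=> u w; rewrite !ffunE => /perm_inj/gi.
pose P f := injectiveb f && (f v == x).
have Pf0 : P f0 by rewrite /P f0v eqxx andbT; apply/injectiveP.
pose f := [arg min_(f < f0 | P f) #|bad_edges f|].
have [Pf minf] : P f /\ forall f', P f' -> #|bad_edges f| <= #|bad_edges f'|.
  by rewrite /f; case: arg_minnP.
have /andP[/injectiveP fi fv] := Pf.
apply/set0Pn; exists f; rewrite inE fv andbT is_embeddingE -[X in X && _]/(injectiveb f).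
have -> /= : injectiveb f by apply/injectiveP.
apply: contraT => /set0Pn[[u w]] huw.
have [a [av ea]] : exists a, a != v /\ ((u == a) || (w == a)).
  have [uv|uv] := eqVneq u v; last by exists u; rewrite eqxx.
  exists w; rewrite eqxx orbT; split=> //; move: huw; rewrite inE /= => /andP[+ _].
  by rewrite -uv; apply: contraTneq => ->; rewrite adj_irrefl.
have : 0 < #|good_swaps f a :\: [set v]|.
  by apply: leq_trans (card_good_swaps _ _ fi); rewrite cards1; lia.
rewrite card_gt0 => /set0Pn[c]; rewrite in_setD in_set1 => /andP[cv hc].
have Pswap : P (swap f a c).
  apply/andP; split; first by apply/injectiveP; exact: swap_inj.
  by rewrite ffunE tpermD.
have := minf _ Pswap; rewrite leqNgt => /negP[]; apply: proper_card.
apply/properP; split.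
  by apply/subsetP => e he; have [] := swap_bad_edges hc he.
exists (u, w) => //; apply/negP => he.
by have [_ /= /negbTE e1 /negbTE e2] := swap_bad_edges hc he; rewrite e1 e2 in ea.
Qed.

Definition agreeing g A := [set f in rooted_embeddings | [forall u in A, f u == g u]].

(* Exchanging the images of [a] and of a good [c] outside [v |: A] is injective in
   the pair [(f, c)], because the new preimage of [g a] is [c]. *)
Lemma agreeingU1 (g : {ffun W -> V}) A a : a != v -> a \notin A ->
  #|agreeing g (a |: A)| * (#|V| - (#|A| + 2 + 2 * (Delta * d))) <= #|agreeing g A|.
Proof.
move=> av aA.
have [->|] := set_0Vmem (agreeing g (a |: A)); first by rewrite cards0.
move=> _.
pose D := [set fc : {ffun W -> V} * W | (fc.1 \in agreeing g (a |: A)) &&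
    (fc.2 \in good_swaps fc.1 a :\: (v |: A))].
have agP f : f \in agreeing g (a |: A) ->
    [/\ is_embedding T G f, injective f, f v = x, f a = g a & forall u, u \in A -> f u = g u].
  rewrite !inE => /andP[/andP[fe /eqP fv] /forall_inP h]; split=> //.
  - by move: fe => /andP[/injectiveP].
  - by apply/eqP/h; rewrite setU11.
  - by move=> u uA; apply/eqP/h; rewrite setU1r.
apply: (@leq_trans #|D|).
  rewrite -sum_nat_const -[leqRHS]sum1_card.
  rewrite [leqRHS](eq_bigl (fun fc : {ffun W -> V} * W => (fc.1 \in agreeing g (a |: A)) &&
    (fc.2 \in good_swaps fc.1 a :\: (v |: A)))); last by move=> fc; rewrite inE.
  rewrite -(pair_big_dep (fun f => f \in agreeing g (a |: A))
     (fun f c => c \in good_swaps f a :\: (v |: A)) (fun _ _ => 1)) /=.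
  apply: leq_sum => f /agP[_ fi _ _ _]; rewrite sum1_card.
  apply: leq_trans (card_good_swaps _ _ fi).
  have := cardsU1 v A; case: (_ \notin _) => /= ->; lia.
have inj : {in D &, injective (fun fc => swap fc.1 a fc.2)}.
  move=> [f c] [f' c']; rewrite !inE /= => /andP[h1 _] /andP[h2 _] e.
  have [_ fi _ fa _] := agP f ltac:(by rewrite !inE).
  have [_ fi' _ fa' _] := agP f' ltac:(by rewrite !inE).
  have ec : c = c'.
    apply: (swap_inj (a := a) (c := c) fi); rewrite {2}e !ffunE !tpermR.
    by rewrite fa fa'.
  subst c'; congr (_, _); apply/ffunP => u.
  by move/ffunP/(_ (tperm a c u)): e; rewrite !ffunE tpermK.
rewrite -(card_in_imset inj); apply: subset_leq_card.
apply/subsetP => _ /imsetP[[f c] + ->]; rewrite inE => /andP[/= hf].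
rewrite in_setD in_setU1 negb_or => /andP[/andP[cv cA] hc].
have [fe fi fv fa fA] := agP f hf.
rewrite inE inE swap_embedding // !ffunE tpermD // fv eqxx /=.
apply/forall_inP => u uA; rewrite ffunE tpermD ?fA //.
  by apply: contraNneq aA => ->.
by apply: contraNneq cA => ->.
Qed.

(* The first [n - s] prescribed values cost a factor [n / L] each; beyond that
   nothing is gained, and [C] absorbs the resulting loss [n ^ s]. *)
Lemma agreeing_spread L C s (g : {ffun W -> V}) A : 0 < C ->
  #|V| <= L * (s - (2 + 2 * (Delta * d))) -> s <= #|V| ->
  #|V| ^ s <= C ^ (#|V| - s) -> v \notin A ->
  #|agreeing g A| * #|V| ^ #|A| <= #|rooted_embeddings| * (C * L) ^ #|A|.
Proof.
move=> C0 hL sV hC vA; set n := #|V| in hL sV hC *.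
have early (B : {set W}) : v \notin B -> #|B| <= n - s ->
    #|agreeing g B| * n ^ #|B| <= #|rooted_embeddings| * L ^ #|B|.
  elim/set_ind: B => [|a B aB IH] vB.
    by rewrite cards0 !expn0 !muln1 => _; apply: subset_leq_card;
       apply/subsetP => f; rewrite inE => /andP[].
  move: vB; rewrite !inE negb_or eq_sym => /andP[av vB]; rewrite cardsU1 aB add1n => hB.
  have {}IH := IH vB (ltnW hB).
  have := agreeingU1 g av aB; rewrite -/n.
  set t := n - _ => ht.
  (* Fewer than [n - s] values are fixed so far, so [t] is at least s - (2 + 2 * (Delta * d)). *)
  have nLt : n <= L * t by apply: leq_trans hL _; rewrite leq_mul2l; apply/orP; right; rewrite /t; lia.
  rewrite !expnS mulnA [leqRHS]mulnCA.
  apply: (@leq_trans (#|agreeing g (a |: B)| * (L * t) * n ^ #|B|)).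
    by rewrite leq_mul2r leq_mul2l nLt !orbT.
  rewrite -!mulnA mulnCA leq_mul2l; apply/orP; right.
  by apply: leq_trans IH; rewrite mulnA leq_mul2r ht orbT.
have [hA|hA] := leqP #|A| (n - s).
  by apply: leq_trans (early A vA hA) _; rewrite expnMn leq_mul2l leq_pmull ?expn_gt0 ?C0 ?orbT.
have [B BA hB] : exists2 B : {set W}, B \subset A & #|B| = n - s.
  exists [set u in take (n - s) (enum A)].
    by apply/subsetP => u; rewrite inE => /mem_take; rewrite mem_enum.
  rewrite cardsE; have /card_uniqP -> : uniq (take (n - s) (enum A)) by rewrite take_uniq ?enum_uniq.
  by rewrite size_take -cardE hA.
have vB : v \notin B by apply: contra vA; apply: (subsetP BA).
have {early} := early B vB; rewrite hB => /(_ (leqnn _)) early.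
have sub : #|agreeing g A| <= #|agreeing g B|.
  apply/subset_leq_card/subsetP => f; rewrite !inE => /andP[-> /forall_inP h].
  by apply/forall_inP => u uB; apply: h; apply: (subsetP BA).
have n0 : 0 < n by rewrite /n -cardWV; apply/card_gt0P; exists v.
have L0 : 0 < L by case: L hL n0 {early} => //; rewrite mul0n; lia.
have An : #|A| <= n by rewrite /n -cardWV max_card.
rewrite -(subnK (ltnW hA)) addnC expnD mulnA.
apply: (@leq_trans (#|rooted_embeddings| * L ^ (n - s) * n ^ s)).
  apply: leq_mul; first by apply: leq_trans early; rewrite leq_mul2r sub orbT.
  by rewrite leq_pexp2l //; lia.
rewrite -mulnA leq_mul2l; apply/orP; right.
rewrite expnMn mulnC leq_mul //.
  by apply: leq_trans hC _; rewrite leq_pexp2l //; lia.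
by rewrite leq_pexp2l //; lia.
Qed.

End Swap.

(** * From vertex-spread to edge-spread *)

(* The head of a longest simple [e]-path is a leaf; making the path end at [v]
   whenever [v] has an [e]-neighbour ensures that the head is not [v]. *)
Lemma forest_leaf (W : finType) (T : sgraph W) (e : rel W) (v u0 w0 : W) :
  acyclic T -> symmetric e -> subrel e T -> e u0 w0 ->
  exists a b, [/\ a != v, e a b & forall c, e a c -> c = b].
Proof.
move=> acT esym eT e0.
have [r [w rw rv]] : exists r, exists2 w, e r w & r != v -> forall w', ~~ e v w'.
  have [/existsP[w vw]|no] := boolP [exists w, e v w].
    by exists v, w => //; rewrite eqxx.
  by exists u0, w0 => // _ w'; apply: contra no => h; apply/existsP; exists w'.
pose P k := [exists h, [exists p : k.-tuple W,
  [&& path e h p, uniq (h :: p) & last h p == r]]].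
have ei u : ~~ e u u by apply/negP => /eT; rewrite adj_irrefl.
have P1 : P 1%N.
  apply/existsP; exists w; apply/existsP; exists [tuple r] => /=.
  by rewrite esym rw eqxx !andbT inE; apply: contraTneq rw => ->.
have Pb k : P k -> (k <= #|W|)%N.
  move=> /existsP[h /existsP[p /and3P[_ up _]]].
  have := max_card (mem (h :: p)); move/card_uniqP: up => ->.
  by rewrite /= size_tuple; apply: ltnW.
have [k Pk kmax] := ex_maxnP (ex_intro (fun k => P k) _ P1) Pb.
have k1 := kmax _ P1.
move: Pk => /existsP[h /existsP[[p /= /eqP sp] /and3P[pp up lp]]].
case: p sp pp up lp => [sp|b p sp]; first by move: k1; rewrite -sp.
move=> pp up lp; have /andP[hb _] := pp.
exists h, b; split => //.
  have [rv'|/rv nv] := eqVneq r v.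
    move: up; rewrite cons_uniq => /andP[hp _].
    by apply: contraNneq hp => ->; rewrite -rv' -(eqP lp) /= mem_last.
  by apply: contraTneq hb => ->.
move=> c hc; apply/eqP; apply: contraT => cb.
(* A second neighbour [c] of [h] either extends the longest path or closes a cycle with its initial
   part. *)
have [cp|cp] := boolP (c \in [:: h, b & p]); last first.
  have : P k.+1.
    apply/existsP; exists c.
    have sz : size [:: h, b & p] == k.+1 by rewrite -sp.
    apply/existsP; exists (Tuple sz); apply/and3P; split => //.
      by rewrite /= esym hc.
    by rewrite cons_uniq cp.
  by move=> /kmax; rewrite ltnn.
move: cp; rewrite !inE (negbTE cb) /= => /orP[/eqP ch|cp].
  by rewrite ch (negbTE (ei h)) in hc.
exfalso; case/splitPr: cp pp up {lp sp} => p1 p2 pp up.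
apply: (acT [:: h, b & rcons p1 c]); first by rewrite /= size_rcons.
have es : b :: p1 ++ c :: p2 = (b :: rcons p1 c) ++ p2 by rewrite /= cat_rcons.
rewrite es in pp up.
have up' : uniq [:: h, b & rcons p1 c].
  have : uniq ([:: h, b & rcons p1 c] ++ p2) by [].
  by rewrite cat_uniq => /andP[].
rewrite /ucycle up' andbT /= rcons_path last_rcons.
move: pp; rewrite cat_path => /andP[pp _].
have ch : T c h by rewrite adj_sym eT.
by have /= /andP[-> ->] := sub_path eT pp.
Qed.

Lemma set2_inj (X : finType) (a b c d : X) : [set a; b] = [set c; d] ->
  (a = c /\ b = d) \/ (a = d /\ b = c).
Proof.
move=> e; have /set2P[ac|ad] : a \in [set c; d] by rewrite -e set21.
  have /set2P[db|->] : d \in [set a; b] by rewrite e set22.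
    left; split=> //; have /set2P[->|//] : b \in [set c; d] by rewrite -e set22.
    by rewrite db.
  by left.
have /set2P[ca|->] : c \in [set a; b] by rewrite e set21.
  left; split=> //; have /set2P[->|//] : b \in [set c; d] by rewrite -e set22.
  by rewrite ca.
by right.
Qed.

Section EdgeSpread.
Local Open Scope nat_scope.
Variables (W V : finType) (T : sgraph W) (G : sgraph V) (v : W) (x : V).
Hypothesis cardWV : #|W| = #|V|.
Hypothesis acT : acyclic T.
Implicit Types (f : {ffun W -> V}) (U : {set {set V}}) (D : {set V}).

Let Delta := max_degree T.

Definition image_edges f : {set {set V}} :=
  [set [set f e.1; f e.2] | e : W * W & T e.1 e.2].

Lemma image_edgesP f (E : {set V}) :
  reflect (exists u w, T u w /\ E = [set f u; f w]) (E \in image_edges f).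
Proof.
apply: (iffP imsetP) => [[[u w]]|[u [w [uw ->]]]].
  by rewrite inE /= => uw ->; exists u, w.
by exists (u, w); rewrite ?inE.
Qed.

(** Inverses of embeddings, remembered only on [D]. The value [v] elsewhere is a default that is
    correct at [x]. *)
Definition homs U D := [set g : {ffun V -> W} | [forall y, (y \notin D) ==> (g y == v)] &&
  [forall y, forall z, ([set y; z] \in U) ==> T (g y) (g z)]].

Lemma homsP U D (g : {ffun V -> W}) :
  reflect ((forall y, y \notin D -> g y = v) /\ (forall y z, [set y; z] \in U -> T (g y) (g z)))
    (g \in homs U D).
Proof.
rewrite inE; apply: (iffP andP) => [[/forallP h1 /forallP h2]|[h1 h2]].
  split=> [y yD|y z yz]; first by apply/eqP; have := h1 y; rewrite yD.
  by have /forallP/(_ z) := h2 y; rewrite yz.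
split; first by apply/forallP => y; apply/implyP => yD; apply/eqP; exact: h1.
by apply/forallP => y; apply/forallP => z; apply/implyP; exact: h2.
Qed.

(* A leaf of the forest [U] other than [x] has at most [Delta] possible labels once
   its neighbour is labelled. *)
Lemma card_homs f0 U D : injective f0 -> f0 v = x -> U \subset image_edges f0 ->
  (forall y z, [set y; z] \in U -> y = x \/ y \in D) ->
  #|homs U D| * #|V| ^ #|U| <= #|V| ^ #|D| * Delta ^ #|U|.
Proof.
move=> fi fv; have [k] := ubnP #|U|; elim: k U D => // k IH U D hk UE UD.
have [U0|[E0 E0U]] := set_0Vmem U.
  rewrite U0 cards0 !expn0 !muln1 -cardWV -(card_pffun_on v (mem D) predT).
  apply: subset_leq_card; apply/subsetP => g /homsP[h _].
  apply/pffun_onP; split=> //.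
  by apply/supportP => y yD; exact: h.
have /image_edgesP[u0 [w0 [uw0 eE0]]] := subsetP UE _ E0U.
(* [U] pulled back along [f0] is a subforest of [T], so it has a leaf [a] other than [v]. *)
pose e : rel W := [rel u w | T u w && ([set f0 u; f0 w] \in U)].
have esym : symmetric e by move=> u w; rewrite /e /= adj_sym setUC.
have eT : subrel e T by move=> u w /andP[].
have e0 : e u0 w0 by rewrite /e /= uw0 -eE0.
have [a [b [av /andP[ab abU] leaf]]] := forest_leaf v acT esym eT e0.
set y := f0 a in abU; set z := f0 b in abU.
have yx : y <> x by rewrite -fv => /fi /eqP; rewrite (negbTE av).
have yz : z != y by apply: contraTneq ab => /fi ->; rewrite adj_irrefl.
have yD : y \in D by have [] := UD _ _ abU.
have yuniq t : [set y; t] \in U -> t = z.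
  move=> ytU; have /image_edgesP[u [w [uw e1]]] := subsetP UE _ ytU.
  have [[/fi e2 ->]|[/fi e2 ->]] := set2_inj e1; subst; rewrite /z; congr (f0 _).
    by apply: leaf; rewrite /e /= uw -e1.
  by apply: leaf; rewrite /e /= adj_sym uw setUC -e1.
pose U' := U :\ [set y; z]; pose D' := D :\ y.
have U'y s t : [set s; t] \in U' -> s != y.
  rewrite in_setD1 => /andP[h1 h2]; apply: contraNneq h1 => sy; subst s.
  by rewrite (yuniq _ h2).
have cU : #|U| = #|U'|.+1 by rewrite (cardsD1 [set y; z]) abU.
have cD : #|D| = #|D'|.+1 by rewrite (cardsD1 y) yD.
have hIH : #|homs U' D'| * #|V| ^ #|U'| <= #|V| ^ #|D'| * Delta ^ #|U'|.
  apply: IH.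
  - by move: hk; rewrite cU.
  - exact: subset_trans (subsetDl _ _) UE.
  - move=> s t stU; have sy := U'y _ _ stU.
    move: stU; rewrite in_setD1 => /andP[_ /UD[->|sD]]; first by left.
    by right; rewrite in_setD1 sy.
(* Forget the label of the leaf [y]; it is one of at most [Delta] neighbours of the label of [z]. *)
pose reset (g : {ffun V -> W}) : {ffun V -> W} := [ffun t => if t == y then v else g t].
pose P2 := [set gw : {ffun V -> W} * W | (gw.1 \in homs U' D') &&
  (gw.2 \in [set w | T (gw.1 z) w])].
have c1 : #|homs U D| <= #|P2|.
  have inj : injective (fun g : {ffun V -> W} => (reset g, g y)).
    move=> g g' [e1 e2]; apply/ffunP => t; have [->//|ty] := eqVneq t y.
    by move/ffunP/(_ t): e1; rewrite !ffunE (negbTE ty).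
  rewrite -(card_imset _ inj); apply: subset_leq_card.
  apply/subsetP => _ /imsetP[g /homsP[h1 h2] ->]; rewrite inE /=; apply/andP; split.
    apply/homsP; split=> [t|s t stU].
      by rewrite in_setD1 ffunE; case: eqP => //= _; exact: h1.
    have sy := U'y _ _ stU; have ty : t != y by apply: (U'y t s); rewrite setUC.
    rewrite !ffunE (negbTE sy) (negbTE ty); apply: h2.
    by move: stU; rewrite in_setD1 => /andP[].
  by rewrite inE ffunE (negbTE yz) adj_sym h2.
have c2 : #|P2| <= #|homs U' D'| * Delta.
  rewrite -[leqLHS]sum1_card [leqLHS](eq_bigl (fun gw : {ffun V -> W} * W => (gw.1 \in homs U' D') &&
    (gw.2 \in [set w | T (gw.1 z) w]))); last by move=> gw; rewrite [LHS]inE.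
  rewrite -(pair_big_dep (fun g => g \in homs U' D')
     (fun g w => w \in [set w | T ((g : {ffun V -> W}) z) w]) (fun _ _ => 1)) /=.
  rewrite -sum_nat_const; apply: leq_sum => g _; rewrite sum1_card.
  exact: degree_le_max.
rewrite cU cD !expnS.
apply: leq_trans (_ : #|homs U' D'| * Delta * (#|V| * #|V| ^ #|U'|) <= _).
  by rewrite leq_mul2r (leq_trans c1 c2) orbT.
rewrite (mulnC #|homs U' D'|) mulnACA.
apply: leq_trans (_ : (Delta * #|V|) * (#|V| ^ #|D'| * Delta ^ #|U'|) <= _).
  by rewrite leq_mul2l hIH orbT.
by rewrite (mulnC Delta) mulnACA.
Qed.

(** Group the embeddings by the labels they give to the set [D] of vertices of [U] other than [x].
    There are at most n ^ (#|D| - #|U|) * Delta ^ #|U| labellings, each shared by a proportion at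
    most (M / n) ^ #|D|; the square comes from #|D| <= 2 * #|U|. *)
Lemma edge_spread M U : 0 < M ->
  (forall (g : {ffun W -> V}) (A : {set W}), v \notin A ->
    #|agreeing T G v x g A| * #|V| ^ #|A| <= #|rooted_embeddings T G v x| * M ^ #|A|) ->
  #|[set f in rooted_embeddings T G v x | U \subset image_edges f]| * #|V| ^ #|U| <=
  #|rooted_embeddings T G v x| * (Delta * M ^ 2) ^ #|U|.
Proof.
move=> M0 hM; set N := [set f in _ | _]; set Om := rooted_embeddings T G v x.
have [->|[f0 f0N]] := set_0Vmem N; first by rewrite cards0.
have NP f : f \in N -> [/\ injective f, f v = x, f \in Om & U \subset image_edges f].
  rewrite inE => /andP[fO fU]; split=> //; move: fO; rewrite inE => /andP[/andP[/injectiveP //]].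
  by move=> _ _ /eqP.
have [f0i f0v f0O f0U] := NP _ f0N.
have n0 : 0 < #|V| by apply/card_gt0P; exists x.
pose D := cover U :\ x.
have cD : #|D| <= 2 * #|U|.
  apply: leq_trans (subset_leq_card (subsetDl _ _)) _; rewrite mulnC.
  apply: card_bigcup_le => E /(subsetP f0U)/image_edgesP[u [w [_ ->]]].
  by rewrite cards2; case: (_ != _).
have UD y z : [set y; z] \in U -> y = x \/ y \in D.
  move=> yzU; have [|yx] := eqVneq y x; first by left.
  by right; rewrite in_setD1 yx; apply/bigcupP; exists [set y; z]; rewrite ?set21.
(* For injective [f] the default [v] is never reached, since [W] and [V] have equal size. *)
pose inv f y := odflt v [pick u | f u == y].
have invK f y : injective f -> f (inv f y) = y.
  move=> fi; rewrite /inv; case: pickP => [u /eqP //|no].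
  have /codomP[u yu] : y \in codom f by apply: inj_card_onto => //; rewrite cardWV.
  by have := no u; rewrite yu eqxx.
pose lab f : {ffun V -> W} := [ffun y => if y \in D then inv f y else v].
have labP f : f \in N -> lab f \in homs U D.
  move=> /NP[fi fv fO fU]; apply/homsP; split=> [y yD|y z yzU].
    by rewrite ffunE (negbTE yD).
  have labK t : t = x \/ t \in D -> f (lab f t) = t.
    rewrite ffunE; case: (boolP (t \in D)) => [tD _|tD [->//|//]]; exact: invK.
  have Ky := labK _ (UD _ _ yzU).
  have Kz := labK z ltac:(by apply: (UD z y); rewrite setUC).
  have /image_edgesP[u [w [uw e1]]] := subsetP fU _ yzU.
  rewrite -Ky -Kz in e1.
  have [[/fi -> /fi -> //]|[/fi -> /fi ->]] := set2_inj e1; by rewrite adj_sym.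
(* Embeddings with the same labels agree on [g @: D], a set of #|D| vertices avoiding [v]. *)
have fiber g : #|[set f in N | lab f == g]| * #|V| ^ #|D| <= #|Om| * M ^ #|D|.
  have [->|[f1]] := set_0Vmem [set f in N | lab f == g]; first by rewrite cards0.
  rewrite inE => /andP[/NP[f1i f1v _ _] /eqP eg].
  have gK f y : injective f -> lab f = g -> y \in D -> f (g y) = y.
    by move=> fi <- yD; rewrite ffunE yD invK.
  have f1g := gK f1 _ f1i eg.
  have cA : #|g @: D| = #|D|.
    by apply: card_in_imset => y z yD zD e; rewrite -(f1g y yD) e f1g.
  have vA : v \notin g @: D.
    apply/negP => /imsetP[y yD e]; have := f1g y yD; rewrite -e f1v => xy.
    by move: yD; rewrite -xy !inE eqxx.
  have := hM f1 _ vA; rewrite cA; apply: leq_trans; rewrite leq_mul2r; apply/orP; right.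
  apply: subset_leq_card; apply/subsetP => f; rewrite inE => /andP[/NP[fi _ fO _] /eqP fg].
  rewrite inE fO; apply/forall_inP => _ /imsetP[y yD ->].
  by rewrite f1g // (gK f).
have cN : #|N| * #|V| ^ #|D| <= #|homs U D| * (#|Om| * M ^ #|D|).
  rewrite -sum1_card (partition_big lab (mem (homs U D))) //= big_distrl /=.
  rewrite -sum_nat_const; apply: leq_sum => g _; apply: leq_trans (fiber g).
  by rewrite leq_mul2r sum1dep_card orbC leqnn.
have ch := card_homs f0i f0v f0U UD.
rewrite -(@leq_pmul2r (#|V| ^ #|D|)) ?expn_gt0 ?n0 //.
apply: (@leq_trans (#|homs U D| * #|V| ^ #|U| * (#|Om| * M ^ #|D|))).
  by rewrite mulnAC [leqRHS]mulnAC leq_mul2r cN orbT.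
apply: (@leq_trans (#|V| ^ #|D| * Delta ^ #|U| * (#|Om| * M ^ #|D|))).
  by rewrite leq_mul2r ch orbT.
apply: (@leq_trans (#|V| ^ #|D| * Delta ^ #|U| * (#|Om| * M ^ (2 * #|U|)))).
  by rewrite !leq_mul2l leq_pexp2l ?orbT.
by rewrite expnMn -expnM mulnACA (mulnC _ #|Om|) [leqRHS]mulnAC.
Qed.

End EdgeSpread.

(** * Lower bound for covers and transfer to the random subgraph *)

(** Union bound: each [f] in [Om] has some [U] of [C] inside its image, and [U] accounts for at most
    a proportion q ^+ #|U| of [Om]. *)
Lemma cost_covers_ge1 (R : realFieldType) (W V : finType) (T : sgraph W)
    (Om : {set {ffun W -> V}}) (C : {set {set {set V}}}) (q : R) :
  (0 < #|Om|)%N ->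
  (forall U : {set {set V}}, #|[set f in Om | U \subset image_edges T f]|%:R <= #|Om|%:R * q ^+ #|U|) ->
  covers C [set image_edges T f | f in Om] -> 1 <= cost q C.
Proof.
move=> Om0 hU /forall_inP cov.
rewrite -(ler_pM2l (_ : 0 < #|Om|%:R)) ?ltr0n // mulr1 /cost mulr_sumr.
apply: le_trans (ler_sum _ (fun U _ => hU U)); rewrite -natr_sum ler_nat.
have sub : Om \subset \bigcup_(U in C) [set f in Om | U \subset image_edges T f].
  apply/subsetP => f fO; have /cov/exists_inP[U UC Uf] := imset_f (image_edges T) fO.
  by apply/bigcupP; exists U => //; rewrite inE fO.
exact: leq_trans (subset_leq_card sub) (card_bigcup_sum _ _).
Qed.

Lemma min_degree_le (V : finType) (G : sgraph V) y : (min_degree G <= degree G y)%N.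
Proof.
rewrite /min_degree; elim: (index_enum V) (mem_index_enum y) => // z s IH.
rewrite in_cons big_cons => /orP[/eqP <-|/IH]; first exact: geq_minl.
by apply: leq_trans; exact: geq_minr.
Qed.

(** The inequality ln (1 + t) <= t at t = - 1/2. *)
Lemma ln2_ge (R : realType) : 2^-1 <= ln (2 : R).
Proof.
have := @le_ln1Dx R (- 2^-1).
have -> : 1 + - 2^-1 = 2^-1 :> R by lra.
rewrite lnV ?posrE //; lra.
Qed.

Lemma random_subgraph_prob_ge (R : realType) (W V : finType) (T : sgraph W) (G : sgraph V)
    (v : W) (x : V) (p : R) : 0 <= p <= 1 ->
  1 - bern_exp p (edges G) (misses R [set image_edges T f | f in rooted_embeddings T G v x]) <=
  random_subgraph_prob G p
    (fun H => [exists f : {ffun W -> V}, is_embedding T H f && (f v == x)]).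
Proof.
move=> hp; rewrite /random_subgraph_prob.
pose A (H : sgraph V) := [exists f : {ffun W -> V}, is_embedding T H f && (f v == x)].
have eA : \sum_(F : {set {set V}} | (F \subset edges G) && A (edge_graph F))
    \prod_(e in edges G) (if e \in F then p else 1 - p) =
    bern_exp p (edges G) (fun F => (A (edge_graph F))%:R).
  rewrite big_mkcondr; apply: eq_bigr => F _.
  by case: (A _); rewrite ?mulr1 ?mulr0.
rewrite eA -[X in X - _](bern_exp_cst p (edges G)) lerBlDr -bern_expD.
apply: ler_bern_exp => // F _; rewrite /misses.
case: (boolP [exists S in [set _ | _ in _], _]) => [/exists_inP[_ /imsetP[f fO ->] fF]|_]; last first.
  by rewrite lerDr ler0n.
suff -> : A (edge_graph F) by rewrite lerDl ler0n.
move: fO; rewrite inE => /andP[/andP[fi _] fv].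
apply/existsP; exists f; rewrite fv andbT; apply/andP; split=> //.
apply/forallP => u; apply/forallP => w; apply/implyP => uw /=.
apply/andP; split.
  by apply: contraTneq uw => /(injectiveP _ fi) ->; rewrite adj_irrefl.
by apply: (subsetP fF); apply/image_edgesP; exists u, w.
Qed.

(** * Choice of numerical parameters *)

Section Numerics.
Local Open Scope nat_scope.
Variables (n l D : nat).
Hypotheses (l8 : 8 <= l) (lo : 2 ^ l <= n) (nl : n < 2 ^ l.+1) (hD : D * l ^ 5 <= 32 * n).

(** Here [D] stands for the product Delta * d and [l] for the integer part of the binary logarithm
    of [n]. With t = n %/ l the choice is s = 3 * t: then 4 * D <= t, and n ^ s <= 2 ^ (3 * t *
    l.+1) with 3 * t * l.+1 <= 6 * n <= 12 * (n - s), since 8 * t <= n. *)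
Lemma spread_parameters : exists s,
  [/\ n <= l * (s - (2 + 2 * D)), s <= n, n ^ s <= (2 ^ 12) ^ (n - s) & 2 + 2 * D < n].
Proof.
have n4 : 4 * l <= n.
  apply: leq_trans lo; rewrite -(subnKC (ltnW (ltnW l8))).
  have := ltn_expl (l - 6) (ltnSn 1); rewrite expnD; lia.
pose t := n %/ l.
have tl : t * l <= n by exact: leq_divM.
have tl1 : n < t.+1 * l by rewrite ltn_ceil //; lia.
have t4 : 4 <= t by rewrite leq_divRL //; lia.
have D4 : 4 * D < t.+1.
  have l4 : 128 <= l ^ 4 by apply: (@leq_trans (4 ^ 4)); rewrite ?leq_exp2r //; lia.
  have : D * l ^ 4 * l < 32 * t.+1 * l.
    by rewrite -mulnA -expnSr (leq_ltn_trans hD) // -mulnA ltn_pmul2l.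
  rewrite ltn_pmul2r; last by lia.
  have : D * 128 <= D * l ^ 4 by rewrite leq_mul2l l4 orbT.
  lia.
have t8 : t * 8 <= n by apply: leq_trans tl; rewrite leq_mul2l l8 orbT.
exists (3 * t); split.
- apply: leq_trans (ltnW tl1) _; rewrite mulnC leq_mul2l; apply/orP; right; lia.
- lia.
- have t0 : 0 < 3 * t by lia.
  apply: (@leq_trans ((2 ^ l.+1) ^ (3 * t))); first by rewrite (leq_exp2r _ _ t0) ltnW.
  rewrite -!expnM; apply: leq_pexp2l => //.
  have : l.+1 * t <= 2 * n by rewrite mulSn [l * t]mulnC; lia.
  by rewrite mulnCA; lia.
- lia.
Qed.

End Numerics.

(** With y = l, the left side is 3(l + 1) repetitions of 2(l + 1) rounds of density 16 q, up to the
    factor Delta / n. It has order y ^+ 4; the fifth power of [y] absorbs the constant. *)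
Lemma edge_probability_budget (R : realFieldType) (y : R) : 2 ^+ 38 <= y ->
  3 * (y + 1) * (2 * (y + 1) * (16 * (2 ^+ 12 * y) ^+ 2)) <= y ^+ 5 / 32.
Proof.
move=> hy.
have y1 : 1 <= y by apply: le_trans hy; rewrite exprn_ege1 // ler1n.
have h1 : (y + 1) ^+ 2 <= 4 * y ^+ 2 by nra.
have y4 : 0 <= y ^+ 4 by rewrite exprn_ge0; lra.
have h2 : (y + 1) ^+ 2 * y ^+ 2 <= 4 * y ^+ 4.
  have -> : 4 * y ^+ 4 = 4 * y ^+ 2 * y ^+ 2 by ring.
  by rewrite ler_wpM2r // exprn_ge0; lra.
have h3 : 2 ^+ 38 * y ^+ 4 <= y ^+ 5 by rewrite (exprS y 4) ler_wpM2r.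
have -> : 3 * (y + 1) * (2 * (y + 1) * (16 * (2 ^+ 12 * y) ^+ 2)) =
          96 * 2 ^+ 24 * ((y + 1) ^+ 2 * y ^+ 2) by ring.
move: y4 h2 h3; set A := (y + 1) ^+ 2 * y ^+ 2; set B := y ^+ 4; set C := y ^+ 5.
by move=> y4 h2 h3; lra.
Qed.

(** * Combination of the estimates *)

Theorem theorem1p8 (R : realType) :
  exists n0 : nat,
  forall (n : nat) (W V : finType) (T : sgraph W) (v : W)
         (G : sgraph V) (x : V) (p : R),
    (n0 <= n)%N -> #|W| = n -> #|V| = n ->
    is_tree T ->
    n%:R - n%:R / ((max_degree T)%:R * ln (n%:R : R) ^+ 5)
      <= (min_degree G)%:R ->
    0 <= p <= 1 ->
    (max_degree T)%:R * ln (n%:R : R) ^+ 5 / n%:R <= p ->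
    1 - n%:R ^- 3 <=
      random_subgraph_prob G p
        (fun H => [exists f : {ffun W -> V}, is_embedding T H f && (f v == x)]).
Proof.
(* [K] is kept abstract so that [2 ^ K] is never evaluated in [nat]. *)
have [K hK] : exists K : nat, 2 ^+ 38 <= K%:R :> R.
  by exists (2 ^ 38)%N; rewrite natrX.
exists (2 ^ K)%N => n W V T v G x p hn cW cV [_ acT] hmin p01 hp.
pose l := trunc_log 2 n.
have n0 : (0 < n)%N by apply: leq_trans hn; rewrite expn_gt0.
have /andP[lo hi] : (2 ^ l <= n < 2 ^ l.+1)%N by exact: trunc_log_bounds.
have Kl : (K <= l)%N by apply: trunc_log_max.
have hl : 2 ^+ 38 <= l%:R :> R by apply: le_trans hK _; rewrite ler_nat.
have l8 : (8 <= l)%N by rewrite -(ler_nat R); apply: le_trans hl; lra.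
have nR : 0 < n%:R :> R by rewrite ltr0n.
set D := max_degree T in hmin hp *; set Lam := ln (n%:R : R) ^+ 5 in hmin hp *.
have hLam : l%:R ^+ 5 / 32 <= Lam.
  have h1 : l%:R / 2 <= ln (n%:R : R).
    apply: (@le_trans _ _ (ln ((2 ^ l)%N%:R : R))); last first.
      by rewrite ler_ln ?posrE ?ltr0n ?expn_gt0 // ler_nat.
    rewrite natrX lnXn // -[leRHS]mulr_natl ler_wpM2l //; exact: ln2_ge.
  have -> : l%:R ^+ 5 / 32 = (l%:R / 2) ^+ 5 :> R by field.
  by rewrite /Lam lerXn2r // nnegrE; [rewrite divr_ge0 | apply: le_trans h1; rewrite divr_ge0].
have Lam0 : 0 < Lam.
  apply: lt_le_trans hLam; rewrite divr_gt0 // exprn_gt0 // ltr0n; lia.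
have degn y : (degree G y < n)%N.
  rewrite -cV -[in ltnRHS](cardsT V) (cardsD1 y [set: V]) inE ltnS.
  apply: subset_leq_card; apply/subsetP => z; rewrite !inE => yz.
  by rewrite andbT; apply: contraTneq yz => ->; rewrite adj_irrefl.
have minn' : (min_degree G < n)%N := leq_ltn_trans (min_degree_le G x) (degn x).
(* If [D] were 0, division by zero giving 0, [hmin] would say that the minimum degree is at least
   [n]. *)
have D0 : (0 < D)%N.
  rewrite lt0n; apply/eqP => D0; move: hmin; rewrite D0 mul0r invr0 mulr0 subr0.
  by rewrite ler_nat leqNgt minn'.
have DR : 0 < D%:R :> R by rewrite ltr0n.
(* A vertex counts among its own non-neighbours. *)
pose d := (n - min_degree G)%N.
have hd y : (#|[set z | ~~ G y z]| <= d)%N.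
  have -> : [set z | ~~ G y z] = ~: [set z | G y z] by apply/setP => z; rewrite !inE.
  by rewrite cardsCs setCK cV leq_sub2l // min_degree_le.
have hDd : (D * d * l ^ 5 <= 32 * n)%N.
  rewrite -(ler_nat R) (natrM R (D * d)) (natrM R D) (natrM R 32) natrX.
  have h1 : d%:R <= n%:R / (D%:R * Lam) by rewrite (natrB _ (ltnW minn')) lerBlDr addrC -lerBlDr.
  have h2 : d%:R * (D%:R * Lam) <= n%:R by rewrite -ler_pdivlMr // mulr_gt0.
  have h3 : d%:R * (D%:R * (l%:R ^+ 5 / 32)) <= n%:R :> R.
    by apply: le_trans h2; rewrite !ler_wpM2l.
  have -> : D%:R * d%:R * l%:R ^+ 5 = 32 * (d%:R * (D%:R * (l%:R ^+ 5 / 32))) :> R by field.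
  by rewrite ler_wpM2l.
have [s [hs1 hs2 hs3 hs4]] := spread_parameters l8 lo hi hDd.
have cWV : #|W| = #|V| by rewrite cW cV.
rewrite -cV in hs1 hs2 hs3 hs4.
pose M := (2 ^ 12 * l)%N.
have C0 : (0 < 2 ^ 12)%N by rewrite expn_gt0.
have M0 : (0 < M)%N by rewrite muln_gt0 expn_gt0 /= (leq_trans _ l8).
(* Vertex-spread with [C] = 2 ^ 12 and [L] = [l] gives [M] = C * L. *)
have sp U := edge_spread cWV acT U M0 (fun g A (vA : v \notin A) =>
  agreeing_spread x cWV hd g C0 hs1 hs2 hs3 vA).
pose Om := rooted_embeddings T G v x.
have Om0 : (0 < #|Om|)%N by rewrite card_gt0; exact: (rooted_embeddings_neq0 v x cWV hd hs4).
pose q : R := D%:R * (2 ^+ 12 * l%:R) ^+ 2 / n%:R.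
have l0 : 0 < l%:R :> R by rewrite ltr0n; lia.
have q0 : 0 < q by rewrite /q divr_gt0 // mulr_gt0 // exprn_gt0 // mulr_gt0 // exprn_gt0.
have spq (U : {set {set V}}) :
    #|[set f in Om | U \subset image_edges T f]|%:R <= #|Om|%:R * q ^+ #|U|.
  rewrite /q expr_div_n mulrA ler_pdivlMr ?exprn_gt0 //.
  have := sp U; rewrite cV -(ler_nat R) !natrM !natrX natrM natrX.
  by rewrite /M natrM natrX.
pose H := [set image_edges T f | f in Om].
have HE S : S \in H -> S \subset edges G.
  move=> /imsetP[f]; rewrite inE => /andP[/andP[_ /forallP fG] _] ->.
  apply/subsetP => E /image_edgesP[u [w [uw ->]]].
  apply/imsetP; exists (f u, f w) => //; rewrite inE /=.
  by have /forallP/(_ w) := fG u; rewrite uw.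
(* At most n ^ 2 ordered pairs and n < 2 ^ l.+1; hence the 2 * l.+1 rounds in [P]. *)
have Hsz S : S \in H -> (#|S| < 2 ^ (2 * l.+1))%N.
  move=> /imsetP[f _ ->]; apply: leq_ltn_trans (leq_imset_card _ _) _.
  apply: leq_ltn_trans (max_card _) _; rewrite card_prod cW mulnn.
  by rewrite (mulnC 2) expnM ltn_exp2r.
have Hc C : covers C H -> 1 <= cost q C by exact: cost_covers_ge1.
pose P : R := (2 * l.+1)%N%:R * (16 * q).
have P0 : 0 <= P by rewrite mulr_ge0 // mulr_ge0 // ltW.
have hrP : (3 * l.+1)%N%:R * P <= p.
  apply: le_trans hp; rewrite /P !natrM -[l.+1%:R]natr1 /q.
  have -> : 3 * (l%:R + 1) * (2 * (l%:R + 1) * (16 * (D%:R * (2 ^+ 12 * l%:R) ^+ 2 / n%:R))) =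
    D%:R / n%:R * (3 * (l%:R + 1) * (2 * (l%:R + 1) * (16 * (2 ^+ 12 * l%:R) ^+ 2))) :> R.
    by field; rewrite gt_eqF.
  rewrite [leRHS]mulrAC ler_wpM2l ?divr_ge0 //.
  exact: le_trans (edge_probability_budget hl) hLam.
have P1 : P <= 1.
  have /andP[_ p1] := p01; apply: le_trans p1; apply: le_trans hrP.
  by rewrite ler_peMl // ler1n muln_gt0.
(* Every cover costs at least 1, so [misses_bound] applies with [theta] = 1. *)
have half : bern_exp P (edges G) (misses R H) <= 2^-1.
  apply: le_trans (misses_bound q0 HE Hsz Hc _) _; first by rewrite lexx.
  rewrite subrr add0r ler_piMr ?invr_ge0 // lerBlDr lerDl.
  by rewrite invr_ge0 exprn_ge0.
have fin : bern_exp p (edges G) (misses R H) <= 2 ^- (3 * l.+1).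
  apply: misses_iter half _; first by rewrite P0.
  by rewrite hrP; have /andP[] := p01.
apply: le_trans (random_subgraph_prob_ge T G v x p01).
rewrite lerD2l lerN2; apply: le_trans fin _.
(* Since n < 2 ^ l.+1, halving 3 * l.+1 times goes below n ^- 3. *)
rewrite lef_pV2 ?posrE ?exprn_gt0 // mulnC exprM lerXn2r ?nnegrE ?exprn_ge0 //.
by rewrite -natrX ler_nat ltnW.
Qed.
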